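(* Fix $\nu\in(0,1)$ and $\pi\in\Lambda$. Assume that the noise random variables $\xi_1,\ldots,\xi_n$ are independent and sub-Gaussian with variance proxy $\sigma^2>0$. Then for any $\beta\ge \frac{2\sigma^2}{\min(\nu,1-\nu)}$ and any $\delta\in(0,1)$, the $Q$-aggregate estimator $\mathsf{f}_{\tilde\lambda}$ (where $\tilde\lambda\in\operatorname{argmin}_{\lambda\in\Lambda}Q(\lambda)$) satisfies $$\operatorname{MSE}(\mathsf{f}_{\tilde\lambda})\le \min_{\lambda\in\Lambda}\Big\{P(\lambda)+\frac{\beta}{n}\mathcal{K}_\rho(\lambda,\pi)+\frac{\beta}{n}\log(1/\delta)\Big\}$$ with probability $1-\delta$ (i.e. at least $1-\delta$). Moreover, $$\mathbb{E}\operatorname{MSE}(\mathsf{f}_{\tilde\lambda})\le \min_{\lambda\in\Lambda}\Big\{P(\lambda)+\frac{\beta}{n}\mathcal{K}_\rho(\lambda,\pi)\Big\}.$$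
   Context: Fixed design regression: $x_1,\ldots,x_n$ are given points of a set $\mathcal{X}$, $f_1,\ldots,f_M:\mathcal{X}\to\mathbb{R}$ are given functions (the dictionary), $\eta:\mathcal{X}\to\mathbb{R}$ is an unknown function, and one observes $Y_i=\eta(x_i)+\xi_i$, $i=1,\ldots,n$. The random vector $\xi=(\xi_1,\ldots,\xi_n)^\top$ is sub-Gaussian with variance proxy $\sigma^2$ if $\mathbb{E}[e^{t^\top\xi}]\le e^{\sigma^2|t|_2^2/2}$ for all $t\in\mathbb{R}^n$ ($|\cdot|_2$ is the Euclidean norm). For $f:\mathcal{X}\to\mathbb{R}$: $\operatorname{MSE}(f)=\frac1n\sum_{i=1}^n(\eta(x_i)-f(x_i))^2$ and $\widehat{\operatorname{MSE}}(f)=\frac1n\sum_{i=1}^n(Y_i-f(x_i))^2$. $\Lambda=\{\lambda\in\mathbb{R}^M:\lambda_j\ge0,\ \sum_{j=1}^M\lambda_j=1\}$ and $\mathsf{f}_\lambda=\sum_{j=1}^M\lambda_jf_j$. $\rho:[0,1]\to\mathbb{R}$ is a fixed function such that $\rho(t)\ge t$ for all $t$ and $t\mapsto t\log\rho(t)$ is convex; $\mathcal{K}_\rho(\lambda,\pi)=\sum_{j=1}^M\lambda_j\log\big(\rho(\lambda_j)/\pi_j\big)$, where terms with $\lambda_j=0$ are taken to be $0$ and terms with $\lambda_j>0=\pi_j$ are $+\infty$. For $\lambda\in\Lambda$, $$Q(\lambda)=(1-\nu)\widehat{\operatorname{MSE}}(\mathsf{f}_\lambda)+\nu\sum_{j=1}^M\lambda_j\widehat{\operatorname{MSE}}(f_j)+\frac{\beta}{n}\mathcal{K}_\rho(\lambda,\pi),\qquad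 P(\lambda)=(1-\nu)\operatorname{MSE}(\mathsf{f}_\lambda)+\nu\sum_{j=1}^M\lambda_j\operatorname{MSE}(f_j).$$ The minimizer $\tilde\lambda$ is a (measurable) function of the data $Y_1,\ldots,Y_n$. *)

(* Defs.v *)
From HB Require Import structures.
From mathcomp Require Import all_boot all_order all_algebra.
From mathcomp Require Import all_classical all_reals all_analysis.

Set Implicit Arguments.
Unset Strict Implicit.
Unset Printing Implicit Defensive.
Import Order.TTheory GRing.Theory Num.Theory.
Local Open Scope classical_set_scope.
Local Open Scope ring_scope.

(** Vectors of R^k are represented as functions ['I_k -> R]. *)

(** Mutual independence. Since [A i] may be the whole line, the product rule
    over all the indices covers every subfamily. *)
Definition independent_RVs (R : realType) (d : measure_display)
    (T : measurableType d) (P : probability T R) (k : nat)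
    (X : 'I_k -> {RV P >-> R}) : Prop :=
  forall A : 'I_k -> set R, (forall i, measurable (A i)) ->
    (P (\bigcap_(i in [set: 'I_k]) (X i @^-1` A i))
       = \prod_(i < k) P (X i @^-1` A i))%E.

(** The random vector [X] of R^k is sub-Gaussian with variance proxy [v];
    a single random variable is the case [k = 1]. *)
Definition sub_gaussian (R : realType) (d : measure_display)
    (T : measurableType d) (P : probability T R) (k : nat)
    (X : 'I_k -> {RV P >-> R}) (v : R) : Prop :=
  forall t : 'I_k -> R,
    ('E_P[fun w => expR (\sum_(i < k) t i * X i w)]
       <= (expR (v * (\sum_(i < k) t i ^+ 2) / 2))%:E)%E.

Definition is_argmin (R : realType) (U : Type) (S : set U)
    (F : U -> \bar R) (a : U) : Prop :=
  S a /\ forall b, S b -> (F a <= F b)%E.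

Section QAggregation.
Context (R : realType) (X : Type) (n M : nat).
Implicit Types (x : 'I_n -> X) (f : 'I_M -> X -> R) (eta g : X -> R).
Implicit Types (Y : 'I_n -> R) (lam pi : 'I_M -> R) (rho : R -> R).

Definition MSE x eta g : R := n%:R^-1 * \sum_(i < n) (eta (x i) - g (x i)) ^+ 2.

Definition empMSE x Y g : R := n%:R^-1 * \sum_(i < n) (Y i - g (x i)) ^+ 2.

(** The flat simplex Lambda of R^M. *)
Definition simplex : set ('I_M -> R) :=
  [set lam | (forall j, 0 <= lam j) /\ \sum_(j < M) lam j = 1].

Definition mixture f lam : X -> R := fun z => \sum_(j < M) lam j * f j z.

(** [K_rho], with the conventions for vanishing weights made explicit. *)
Definition Krho rho lam pi : \bar R :=
  (\sum_(j < M) if lam j == 0%R then 0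
                else if pi j == 0%R then +oo
                else (lam j * ln (rho (lam j) / pi j))%:E)%E.

Definition Qcrit x f rho pi (nu beta : R) Y lam : \bar R :=
  (((1 - nu) * empMSE x Y (mixture f lam)
     + nu * \sum_(j < M) lam j * empMSE x Y (f j))%R%:E
   + (beta / n%:R)%:E * Krho rho lam pi)%E.

Definition Pcrit x f eta (nu : R) lam : R :=
  (1 - nu) * MSE x eta (mixture f lam)
    + nu * \sum_(j < M) lam j * MSE x eta (f j).

End QAggregation.

Arguments simplex : clear implicits.

(** The observations [Y_i = eta (x_i) + xi_i], at the outcome [w]. *)
Definition obs (R : realType) (X : Type) (n : nat) (d : measure_display)
    (T : measurableType d) (P : probability T R)
    (x : 'I_n -> X) (eta : X -> R) (xi : 'I_n -> {RV P >-> R}) (w : T) :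
    n.-tuple R :=
  [tuple eta (x i) + xi i w | i < n].

(* Main.v *)
Require Import Defs.
From HB Require Import structures.
From mathcomp Require Import all_boot all_order all_algebra.
From mathcomp Require Import all_classical all_reals all_analysis.
From mathcomp Require Import measurable_realfun ring lra.

Set Implicit Arguments.
Unset Strict Implicit.
Unset Printing Implicit Defensive.
Import Order.TTheory GRing.Theory Num.Theory.
Local Open Scope classical_set_scope.
Local Open Scope ring_scope.

(** Write D(g, h) for the normalized squared distance of g and h at the design
    points, K for K_rho(., pi), a for the selected weights, and
    m = min(nu, 1 - nu).

    The criterion Q is (1 - nu) times the squared distance from f_lambda to the
    data, plus a convex function of lambda, so it grows quadratically away from
    its minimizer:
    Q(a) + (1 - nu) D(f_a, f_lambda) <= Q(lambda) ([argmin_growth]).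
    Substituting Y = eta + xi turns this into an inequality on P in which the
    noise enters only through the linear term 2/n <xi, f_a - f_lambda>.  By the
    bias-variance identity P(a) exceeds MSE(f_a) by nu sum_j a_j D(f_a, f_j),
    and the two quadratic gains together dominate
    m sum_j a_j D(f_lambda, f_j).  The whole remainder is then linear in the
    weights a, up to the penalty - (beta/n) K(a), and K(a) is at least the
    relative entropy of a with respect to pi because rho(t) >= t.  The Gibbs
    variational principle replaces the random weights a by the fixed weights
    pi: the remainder is at most (beta/n) (s + e^{-s} U - 1) for every real s,
    where
      U = sum_j pi_j exp((2/beta) <xi, f_j - f_lambda>
                         - (m n / beta) D(f_lambda, f_j))
    ([oracle_inequality]).

    Independence makes xi sub-Gaussian as a vector ([indep_sub_gaussian]), and
    beta >= 2 sigma^2 / m is exactly what makes the quadratic correction in U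
    pay for the moment generating function, so E U <= 1
    ([integral_exp_moment_le1]).  The choice s = 0 gives the bound in
    expectation; s = log(1/delta) and Markov's inequality give, for each fixed
    lambda, the bound in probability.

    The bound in probability has the infimum over lambda inside the event, and
    the infimum need not be attained, as t log rho(t) may jump at t = 1.  Along
    a decreasing sequence of values tending to the infimum the events decrease,
    so continuity of the measure from above is enough ([prob_le_inf]). *)

(** * Quadratic growth of the criterion *)

Lemma convex_function_segment (R : realType) (D : set R) (g : R -> R)
    (a b t : R) :
  convex_function D g -> a \in D -> b \in D -> 0 <= t -> t <= 1 ->
  g ((1 - t) * a + t * b) <= (1 - t) * g a + t * g b.
Proof.
move=> cvx aD bD t0 t1.
have : g (t * b + (1 - t) * a) <= t * g b + (1 - t) * g a.
  exact: (cvx (Itv01 t0 t1) b a bD aD).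
by rewrite addrC [leRHS]addrC.
Qed.

Section Deterministic.
Context (R : realType) (X : Type) (n M : nat).
Context (x : 'I_n -> X) (f : 'I_M -> X -> R).
Implicit Types (g h eta : X -> R) (Y z : 'I_n -> R) (a b lam pi : 'I_M -> R).

Lemma simplex_le1 lam j : simplex R M lam -> lam j <= 1.
Proof.
move=> [lam0 <-]; rewrite (bigD1 j)//= lerDl.
by apply: sumr_ge0 => i _.
Qed.

Lemma simplex_segment a b (t : R) : 0 <= t <= 1 ->
  simplex R M a -> simplex R M b ->
  simplex R M (fun j => (1 - t) * a j + t * b j).
Proof.
move=> /andP[t0 t1] [a0 a1] [b0 b1]; split=> [j|].
  by rewrite addr_ge0// mulr_ge0// subr_ge0.
by rewrite big_split/= -!mulr_sumr a1 b1 !mulr1 subrK.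
Qed.

Lemma mixture_segment a b (t : R) :
  mixture f (fun j => (1 - t) * a j + t * b j) =
  (fun u => (1 - t) * mixture f a u + t * mixture f b u).
Proof.
apply/funext => u; rewrite /mixture !mulr_sumr -big_split/=.
by apply: eq_bigr => j _; ring.
Qed.

(** The parallelogram identity: the negative term is the strong convexity of the
    squared error, the source of the quadratic growth of the criterion. *)
Lemma empMSE_segment Y g h (t : R) :
  empMSE x Y (fun u => (1 - t) * g u + t * h u) =
  (1 - t) * empMSE x Y g + t * empMSE x Y h - t * (1 - t) * MSE x g h.
Proof.
rewrite /empMSE /MSE !mulrA -!(mulrC n%:R^-1) -!mulrA -mulrDr -mulrBr.
congr (_ * _); rewrite !mulr_sumr -big_split/= -sumrB.
by apply: eq_bigr => i _; ring.
Qed.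

(** The values f_j(x_i), drawn with probabilities a_j, have mean f_a(x_i). *)
Lemma bias_variance a g : simplex R M a ->
  \sum_(j < M) a j * MSE x g (f j) =
  MSE x g (mixture f a) + \sum_(j < M) a j * MSE x (mixture f a) (f j).
Proof.
move=> [_ a1]; apply/eqP; rewrite -subr_eq; apply/eqP.
have -> : MSE x g (mixture f a) =
  n%:R^-1 * \sum_(i < n) \sum_(j < M)
     a j * ((g (x i) - f j (x i)) ^+ 2 - (mixture f a (x i) - f j (x i)) ^+ 2).
  rewrite /MSE; congr (_ * _); apply: eq_bigr => i _.
  set u := g (x i); set v := mixture f a (x i).
  transitivity (\sum_(j < M) ((u ^+ 2 - v ^+ 2) * a j
                                - 2 * (u - v) * (a j * f j (x i)))).
    rewrite sumrB -!mulr_sumr a1 -/(mixture f a (x i)) -/v; ring.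
  by apply: eq_bigr => j _; ring.
rewrite exchange_big/= mulr_sumr -sumrB; apply: eq_bigr => j _.
rewrite /MSE -mulrBr -mulr_sumr sumrB -mulrBr; ring.
Qed.

Lemma empMSE_noise eta z g :
  empMSE x (fun i => eta (x i) + z i) g =
  MSE x eta g + 2 / n%:R * \sum_(i < n) z i * (eta (x i) - g (x i))
    + n%:R^-1 * \sum_(i < n) z i ^+ 2.
Proof.
rewrite /empMSE /MSE -[2 / _](mulrC n%:R^-1) -(mulrA _ 2) -!mulrDr.
by congr (_ * _); rewrite mulr_sumr -!big_split/=; apply: eq_bigr => i _; ring.
Qed.

Lemma sum_mulrB (u v w : 'I_n -> R) :
  \sum_(i < n) w i * (u i - v i) =
  \sum_(i < n) w i * u i - \sum_(i < n) w i * v i.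
Proof. by rewrite -sumrB; apply: eq_bigr => i _; rewrite mulrBr. Qed.

Lemma sum_mixture (w : 'I_n -> R) a :
  \sum_(j < M) a j * (\sum_(i < n) w i * f j (x i)) =
  \sum_(i < n) w i * mixture f a (x i).
Proof.
under eq_bigr do rewrite mulr_sumr.
rewrite exchange_big/=; apply: eq_bigr => i _; rewrite /mixture mulr_sumr.
by apply: eq_bigr => j _; ring.
Qed.

(** Absolute continuity of [lam] with respect to [pi]: the domain where K_rho is
    finite. *)
Definition dominated lam pi := forall j, pi j = 0 -> lam j = 0.

(** The logarithm of the quotient is split: the part in [pi] is then linear in
    [lam], and the summands with [lam j = 0] vanish whatever [pi j] is. *)
Definition Krho_real (rho : R -> R) lam pi : R :=
  \sum_(j < M) (lam j * ln (rho (lam j)) - lam j * ln (pi j)).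

Lemma simplex_gt0 lam j : simplex R M lam -> lam j != 0 -> 0 < lam j.
Proof. by move=> [l0 _] ln0; rewrite lt_def ln0 l0. Qed.

Lemma Krho_dominated (rho : R -> R) lam pi :
  (forall t, 0 <= t <= 1 -> t <= rho t) ->
  simplex R M lam -> simplex R M pi -> dominated lam pi ->
  Krho rho lam pi = (Krho_real rho lam pi)%:E.
Proof.
move=> rho_ge sl sp dom; rewrite /Krho /Krho_real -sumEFin.
apply: eq_bigr => j _; case: eqVneq => [->|l0]; first by rewrite !mul0r subrr.
case: eqVneq => [/dom e|p0]; first by rewrite e eqxx in l0.
have lj := simplex_gt0 sl l0; have pj := simplex_gt0 sp p0.
have rj : 0 < rho (lam j).
  by apply: (lt_le_trans lj); apply: rho_ge; rewrite ltW// simplex_le1.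
by rewrite ln_div ?posrE// mulrBr.
Qed.

Lemma Krho_not_dominated (rho : R -> R) lam pi :
  ~ dominated lam pi -> Krho rho lam pi = +oo%E.
Proof.
move=> /existsNP[j /not_implyP[p0 /eqP l0]]; apply/eqP.
rewrite esum_eqy; last first.
  by move=> i _; case: ifP => // _; case: ifP.
by apply/existsP; exists j; rewrite (negPf l0) p0 eqxx.
Qed.

(** Each summand is t log rho(t) minus a linear function of t. *)
Lemma Krho_real_segment (rho : R -> R) a b pi (t : R) :
  convex_function (`[0, 1]%classic : set R) (fun u => u * ln (rho u)) ->
  0 <= t <= 1 -> simplex R M a -> simplex R M b ->
  Krho_real rho (fun j => (1 - t) * a j + t * b j) pi <=
  (1 - t) * Krho_real rho a pi + t * Krho_real rho b pi.
Proof.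
move=> rho_convex /andP[t0 t1] sa sb.
rewrite /Krho_real !mulr_sumr -big_split/=; apply: ler_sum => j _.
have inI lam : simplex R M lam -> lam j \in (`[0, 1]%classic : set R).
  by move=> sl; rewrite inE/= in_itv/= simplex_le1// andbT; case: sl.
have := convex_function_segment rho_convex (inI a sa) (inI b sb) t0 t1.
set u := (1 - t) * a j + t * b j => le_u.
set w := u * ln (rho u) in le_u *; rewrite /u; lra.
Qed.

(** Gibbs variational principle, with the logarithm of the partition function
    Z = sum_j pi_j e^{h_j} linearized: log Z <= s + e^{-s} Z - 1.  The linear
    form in Z can be integrated as it is. *)
Lemma gibbs_inequality a pi (h : 'I_M -> R) (s : R) :
  simplex R M a -> simplex R M pi -> dominated a pi ->
  \sum_(j < M) a j * h j - \sum_(j < M) (a j * ln (a j) - a j * ln (pi j)) <=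
  s + expR (- s) * (\sum_(j < M) pi j * expR (h j)) - 1.
Proof.
move=> sa sp dom; have [a0 a1] := sa; have [p0 p1] := sp.
have -> : s + expR (- s) * (\sum_(j < M) pi j * expR (h j)) - 1 =
  \sum_(j < M) (a j * s + pi j * expR (h j - s) - a j).
  rewrite sumrB big_split/= -mulr_suml a1 mul1r; congr (_ + _ - _).
  by rewrite mulr_sumr; apply: eq_bigr => j _; rewrite expRD; ring.
rewrite -sumrB; apply: ler_sum => j _.
have [->|aj0] := eqVneq (a j) 0.
  by rewrite !mul0r !subr0 add0r mulr_ge0// expR_ge0.
have aj := simplex_gt0 sa aj0.
have pj : 0 < pi j by rewrite lt_def p0 andbT; apply: contra_neq aj0 => /dom.
(* Termwise, the claim is w + 1 <= e^w. *)
set w := (h j - s) + (ln (pi j) - ln (a j)).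
have -> : pi j * expR (h j - s) = a j * expR w.
  rewrite /w [in RHS]expRD [expR (ln _ - _)]expRB !lnK ?posrE//.
  by field; exact: lt0r_neq0.
have := ler_wpM2l (ltW aj) (expR_ge1Dx w); rewrite /w; lra.
Qed.

Section ClosedForm.
Context (rho : R -> R) (pi : 'I_M -> R) (nu beta : R) (Y : 'I_n -> R).
Context (rho_ge : forall t : R, 0 <= t <= 1 -> t <= rho t)
  (rho_convex :
     convex_function (`[0, 1]%classic : set R) (fun t => t * ln (rho t)))
  (pi_simplex : simplex R M pi) (n_gt0 : (0 < n)%N)
  (beta_gt0 : 0 < beta) (nu01 : 0 < nu < 1).

Definition Qcrit_real lam : R :=
  (1 - nu) * empMSE x Y (mixture f lam)
  + nu * (\sum_(j < M) lam j * empMSE x Y (f j))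
  + beta / n%:R * Krho_real rho lam pi.

Let c_gt0 : 0 < beta / n%:R.
Proof. by rewrite divr_gt0// ltr0n. Qed.

Lemma Qcrit_dominated lam : simplex R M lam -> dominated lam pi ->
  Qcrit x f rho pi nu beta Y lam = (Qcrit_real lam)%:E.
Proof. by move=> sl dl; rewrite /Qcrit Krho_dominated. Qed.

Lemma Qcrit_not_dominated lam : ~ dominated lam pi ->
  Qcrit x f rho pi nu beta Y lam = +oo%E.
Proof.
by move=> nd; rewrite /Qcrit Krho_not_dominated// gt0_muley ?lte_fin.
Qed.

(** The criterion is finite at [pi], hence at its minimizers. *)
Lemma argmin_dominated a :
  is_argmin (simplex R M) (Qcrit x f rho pi nu beta Y) a -> dominated a pi.
Proof.
move=> [sa /(_ pi pi_simplex)]; rewrite (Qcrit_dominated pi_simplex)//.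
by apply: contraPP => /Qcrit_not_dominated ->.
Qed.

Lemma Qcrit_real_segment a b (t : R) : 0 <= t <= 1 ->
  simplex R M a -> simplex R M b ->
  Qcrit_real (fun j => (1 - t) * a j + t * b j) <=
  (1 - t) * Qcrit_real a + t * Qcrit_real b
    - (1 - nu) * (t * (1 - t)) * MSE x (mixture f a) (mixture f b).
Proof.
move=> t01 sa sb; rewrite /Qcrit_real mixture_segment empMSE_segment.
have -> : \sum_(j < M) ((1 - t) * a j + t * b j) * empMSE x Y (f j) =
  (1 - t) * (\sum_(j < M) a j * empMSE x Y (f j))
  + t * (\sum_(j < M) b j * empMSE x Y (f j)).
  by rewrite !mulr_sumr -big_split/=; apply: eq_bigr => j _; ring.
have := ler_wpM2l (ltW c_gt0) (Krho_real_segment pi rho_convex t01 sa sb).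
set c := beta / _; lra.
Qed.

(** Comparing [a] with (1 - t) a + t lam gives the inequality with the factor
    1 - t in front of the distance; then t tends to 0. *)
Lemma argmin_growth a lam :
  is_argmin (simplex R M) (Qcrit x f rho pi nu beta Y) a ->
  simplex R M lam -> dominated lam pi ->
  Qcrit_real a + (1 - nu) * MSE x (mixture f a) (mixture f lam)
  <= Qcrit_real lam.
Proof.
move=> amin sl dl; have da := argmin_dominated amin.
have [sa min_a] := amin; set D := MSE x _ _.
have step t : 0 < t < 1 ->
    Qcrit_real a + (1 - nu) * (1 - t) * D <= Qcrit_real lam.
  move=> /andP[t0 t1]; have t01 : 0 <= t <= 1 by rewrite !ltW.
  have st := simplex_segment t01 sa sl.
  have dt : dominated (fun j => (1 - t) * a j + t * lam j) pi.
    by move=> j pj; rewrite (da j pj) (dl j pj) !mulr0 addr0.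
  have := min_a _ st; rewrite !Qcrit_dominated// lee_fin.
  move=> /le_trans/(_ (Qcrit_real_segment t01 sa sl)).
  rewrite -/D => h; rewrite -(ler_pM2l t0); lra.
apply/ler_addgt0Pl => e e0.
have D0 : 0 <= D.
  by rewrite /D/MSE mulr_ge0 ?invr_ge0// sumr_ge0// => i _; exact: sqr_ge0.
have [nu0 nu1] := andP nu01.
have G0 : 0 <= (1 - nu) * D by rewrite mulr_ge0// subr_ge0 ltW.
have E0 : 0 < e + (1 - nu) * D + 1 by lra.
(* Chosen so that the loss [t * ((1 - nu) * D)] is at most [e], and t < 1. *)
pose t := e / (e + (1 - nu) * D + 1).
have t01 : 0 < t < 1.
  by rewrite /t divr_gt0//= ltr_pdivrMr// mul1r; lra.
have := step t t01.
have : t * ((1 - nu) * D) <= e.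
  rewrite /t mulrAC ler_pdivrMr// ler_wpM2l//; [exact: ltW|lra].
lra.
Qed.
End ClosedForm.

(** * The deterministic oracle inequality *)

Lemma Pcrit_variance eta (nu : R) a : simplex R M a ->
  Pcrit x f eta nu a =
  MSE x eta (mixture f a) + nu * \sum_(j < M) a j * MSE x (mixture f a) (f j).
Proof. by move=> sa; rewrite /Pcrit bias_variance//; ring. Qed.

(** The last term does not depend on the weights, so it disappears when two
    values of the criterion are compared. *)
Lemma Qcrit_real_noise rho pi (nu beta : R) eta z a : simplex R M a ->
  Qcrit_real rho pi nu beta (fun i => eta (x i) + z i) a =
  Pcrit x f eta nu a + beta / n%:R * Krho_real rho a pi
  + 2 / n%:R * \sum_(i < n) z i * (eta (x i) - mixture f a (x i))
  + n%:R^-1 * \sum_(i < n) z i ^+ 2.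
Proof.
move=> [_ a1]; rewrite /Qcrit_real /Pcrit empMSE_noise.
set N := _ * \sum_(i < n) z i ^+ 2.
set L := 2 / _ * \sum_(i < n) _.
have -> : \sum_(j < M) a j * empMSE x (fun i => eta (x i) + z i) (f j) =
  \sum_(j < M) a j * MSE x eta (f j) + L + N; last by ring.
transitivity (\sum_(j < M) (a j * MSE x eta (f j) + a j * N
  + 2 / n%:R * ((\sum_(i < n) z i * eta (x i)) * a j
                - a j * \sum_(i < n) z i * f j (x i)))).
  apply: eq_bigr => j _; rewrite empMSE_noise -/N.
  by rewrite sum_mulrB; ring.
rewrite !big_split/= -mulr_suml a1 -mulr_sumr sumrB sum_mixture -mulr_sumr a1.
by rewrite /L sum_mulrB; ring.
Qed.

(** The partition function left by the Gibbs principle when the exponents are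
    the noise terms of the differences f_j - f_lam, compensated by their squared
    norms. *)
Definition exp_moment pi (beta m : R) lam z : R :=
  \sum_(j < M) pi j *
    expR (2 / beta * (\sum_(i < n) z i * (f j (x i) - mixture f lam (x i)))
          - m / beta * \sum_(i < n) (f j (x i) - mixture f lam (x i)) ^+ 2).

(** The random weights [a] are traded for the fixed weights [pi]; [s] is free,
    to be chosen according to the probabilistic use. *)
Lemma oracle_inequality (rho : R -> R) pi (nu beta s : R) eta z a lam :
  (forall t : R, 0 <= t <= 1 -> t <= rho t) ->
  convex_function (`[0, 1]%classic : set R) (fun t => t * ln (rho t)) ->
  simplex R M pi -> (0 < n)%N -> 0 < beta -> 0 < nu < 1 ->
  is_argmin (simplex R M)
    (Qcrit x f rho pi nu beta (fun i => eta (x i) + z i)) a ->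
  simplex R M lam -> dominated lam pi ->
  MSE x eta (mixture f a) <=
  Pcrit x f eta nu lam + beta / n%:R * Krho_real rho lam pi
  + beta / n%:R *
    (s + expR (- s) * exp_moment pi beta (Num.min nu (1 - nu)) lam z - 1).
Proof.
move=> rho_ge rho_convex sp n0 b0 nu01 amin sl dl.
have c0 : 0 < beta / n%:R by rewrite divr_gt0// ltr0n.
have nn0 : n%:R != 0 :> R by rewrite pnatr_eq0 -lt0n.
have sa := amin.1.
have := argmin_growth rho_ge rho_convex sp n0 b0 nu01 amin sl dl.
have da := argmin_dominated rho_ge sp n0 b0 amin.
rewrite !Qcrit_real_noise// (Pcrit_variance eta nu sa).
set m := Num.min _ _; set D := MSE x (mixture f a) _.
set V := \sum_(j < M) a j * _; set N := n%:R^-1 * _.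
set c := beta / n%:R.
have DV : \sum_(j < M) a j * MSE x (mixture f lam) (f j) = D + V.
  rewrite bias_variance// /D /V; congr (_ + _).
  by rewrite /MSE; congr (_ * _); apply: eq_bigr => i _; ring.
have MSE0 g h : 0 <= MSE x g h.
  by rewrite /MSE mulr_ge0 ?invr_ge0// sumr_ge0// => i _; exact: sqr_ge0.
have V0 : 0 <= V by apply: sumr_ge0 => j _; rewrite mulr_ge0// sa.1.
(* Both quadratic gains are reduced to the common factor [m], so that their sum
   becomes linear in [a] by the bias-variance identity. *)
have mD : m * D <= (1 - nu) * D.
  by apply: ler_wpM2r; [exact: MSE0|rewrite ge_min lexx orbT].
have mV : m * V <= nu * V by apply: ler_wpM2r; rewrite // /m ge_min lexx.
have ent :
    \sum_(j < M) (a j * ln (a j) - a j * ln (pi j)) <= Krho_real rho a pi.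
  apply: ler_sum => j _; rewrite lerD2r; have [->|aj0] := eqVneq (a j) 0.
    by rewrite !mul0r.
  have aj := simplex_gt0 sa aj0.
  apply: ler_wpM2l; first exact: ltW.
  have le_r : a j <= rho (a j) by apply: rho_ge; rewrite ltW// simplex_le1.
  by rewrite ler_ln ?posrE// (lt_le_trans aj).
pose h j := 2 / beta * (\sum_(i < n) z i * (f j (x i) - mixture f lam (x i)))
          - m / beta * \sum_(i < n) (f j (x i) - mixture f lam (x i)) ^+ 2.
have := gibbs_inequality h s sa sp da.
have ah : \sum_(j < M) a j * h j =
  2 / beta * (\sum_(i < n) z i * mixture f a (x i)
              - \sum_(i < n) z i * mixture f lam (x i))
  - m * n%:R / beta * (D + V).
  rewrite -DV -sum_mixture.
  transitivity (\sum_(j < M) (2 / beta * (a j * (\sum_(i < n) z i * f j (x i)))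
     - 2 / beta * (\sum_(i < n) z i * mixture f lam (x i)) * a j
     - m * n%:R / beta * (a j * MSE x (mixture f lam) (f j)))).
    apply: eq_bigr => j _; rewrite /h /MSE.
    rewrite sum_mulrB.
    under [X in _ - m / beta * X]eq_bigr do rewrite -sqrrN opprB.
    by field; rewrite nn0 gt_eqF.
  by rewrite !sumrB -!mulr_sumr sa.2; ring.
have cb : c * (2 / beta) = 2 / n%:R by rewrite /c; field; rewrite nn0 gt_eqF.
have cm : c * (m * n%:R / beta) = m by rewrite /c; field; rewrite nn0 gt_eqF.
rewrite ah -/(exp_moment pi beta m lam z) => G1.
have : c * (2 / beta * (\sum_(i < n) z i * mixture f a (x i)
              - \sum_(i < n) z i * mixture f lam (x i))
  - m * n%:R / beta * (D + V) - Krho_real rho a pi) <=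
  c * (s + expR (- s) * exp_moment pi beta m lam z - 1).
  by rewrite ler_pM2l//; apply: le_trans G1; rewrite lerD2l lerN2.
rewrite (_ : c * _ = 2 / n%:R * (\sum_(i < n) z i * mixture f a (x i)
    - \sum_(i < n) z i * mixture f lam (x i)) - m * (D + V)
    - c * Krho_real rho a pi); last by rewrite -cb -[in RHS]cm; ring.
move=> G2.
rewrite !(sum_mulrB _ _ z).
move: G2; set A1 := \sum_(i < n) z i * mixture f a (x i).
set A2 := \sum_(i < n) z i * mixture f lam (x i).
set A3 := \sum_(i < n) z i * eta (x i).
lra.
Qed.
End Deterministic.

(** * Sub-Gaussian vectors from independent coordinates *)

Section Independence.
Context (R : realType) d (T : measurableType d) (P : probability T R).
Import HBNNSimple.
Local Open Scope ereal_scope.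

(** Passage from indicators to nonnegative functions of [X]: linearity for
    simple functions, then monotone convergence. *)
Lemma integral_indic_to_fun (H : T -> R) (X : {RV P >-> R}) (c : R)
    (g : R -> R) :
  measurable_fun [set: T] H -> (forall w, 0 <= H w)%R -> (0 <= c)%R ->
  measurable_fun [set: R] g -> (forall r, 0 <= g r)%R ->
  (forall A, measurable A ->
     \int[P]_w (H w * \1_A (X w))%:E = c%:E * P (X @^-1` A)) ->
  \int[P]_w (H w * g (X w))%:E = c%:E * \int[P]_w (g (X w))%:E.
Proof.
move=> mH H0 c0 mg g0 HA.
have mX : measurable_fun [set: T] X by [].
have mgE := (measurable_EFinP _ _).2 mg.
pose h := nnsfun_approx measurableT mgE.
have mh k : measurable_fun [set: T] (fun w => h k (X w)).
  exact: (measurableT_comp (measurable_funP (h k)) mX).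
have hcvg w : (h k (X w))%:E @[k --> \oo] --> (g (X w))%:E.
  by apply: (cvg_nnsfun_approx measurableT mgE) => // ? _; rewrite lee_fin.
have h0 k r : (0 <= h k r)%R by [].
have hnd w : {homo (fun k => h k (X w)) : k l / (k <= l)%N >-> (k <= l)%R}.
  by move=> k l kl; exact/lefP/nd_nnsfun_approx.
have lim_of (K : T -> R) :
    measurable_fun [set: T] K -> (forall w, 0 <= K w)%R ->
    \int[P]_w (K w * h k (X w))%:E @[k --> \oo] -->
    \int[P]_w (K w * g (X w))%:E.
  move=> mK K0.
  have -> : \int[P]_w (K w * g (X w))%:E =
      \int[P]_w limn (fun k => (K w * h k (X w))%:E).
    apply: eq_integral => w _; apply/esym/cvg_lim => //.
    under eq_fun do rewrite EFinM; rewrite EFinM.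
    exact: cvgeZl.
  apply: (cvg_monotone_convergence measurableT).
  - by move=> k; apply/measurable_EFinP; exact: measurable_funM.
  - by move=> k w _; rewrite lee_fin mulr_ge0.
  - by move=> w _ k l kl; rewrite lee_fin ler_wpM2l// hnd.
suff step k : \int[P]_w (H w * h k (X w))%:E = c%:E * \int[P]_w (h k (X w))%:E.
  have L1 := lim_of H mH H0.
  have L2 : \int[P]_w (h k (X w))%:E @[k --> \oo] --> \int[P]_w (g (X w))%:E.
    have := lim_of (cst 1%R) (measurable_cst _) (fun=> ler01).
    rewrite (_ : (fun k => _) = (fun k => \int[P]_w (h k (X w))%:E));
      last first.
      by apply/funext => k; apply: eq_integral => w _; rewrite mul1r.
    by under [X in _ --> X -> _]eq_integral do rewrite mul1r.
  rewrite (funext step) in L1.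
  have cfin : c%:E \is a fin_num by [].
  have L3 := cvgeZl cfin L2.
  exact: (cvg_unique (@ereal_hausdorff R) L1 L3).
have indE w : (h k (X w))%:E =
    \sum_(y \in range (h k)) (y * \1_(h k @^-1` [set y]) (X w))%:E.
  by rewrite fimfunE -fsumEFin.
have mI y : measurable_fun [set: T]
    (fun w => \1_(h k @^-1` [set y]) (X w) : R).
  by apply: measurableT_comp.
have I0 y w : (0 <= y * \1_(h k @^-1` [set y]) (X w))%R.
  by have := @nnfun_muleindic_ge0 _ _ _ (h k) y (X w); rewrite lee_fin.
transitivity (\int[P]_w (\sum_(y \in range (h k))
    (H w * (y * \1_(h k @^-1` [set y]) (X w)))%:E)).
  apply: eq_integral => w _; rewrite EFinM indE ge0_mule_fsumr//.
  by move=> y; rewrite lee_fin.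
rewrite ge0_integral_fsum//; last 2 first.
  - move=> y; apply/measurable_EFinP; apply: measurable_funM => //.
    exact: measurable_funM.
  - by move=> y w _; rewrite lee_fin mulr_ge0.
under [in RHS]eq_integral do rewrite indE.
rewrite ge0_integral_fsum//; last 2 first.
  - by move=> y; apply/measurable_EFinP; exact: measurable_funM.
  - by move=> y w _; rewrite lee_fin.
rewrite ge0_mule_fsumr; last first.
  by move=> y; apply: integral_ge0 => w _; rewrite lee_fin.
apply: eq_fsbigr => y; rewrite inE => -[u _ <-].
set r := h k u; set B := h k @^-1` [set r].
have r0 : (0 <= r)%R by exact: h0.
under eq_integral do rewrite mulrCA EFinM.
rewrite ge0_integralZl_EFin//; last 2 first.
  - by move=> w _; rewrite lee_fin mulr_ge0.
  - by apply/measurable_EFinP; exact: measurable_funM mH (mI r).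
have mB : measurable B.
  exact: (measurable_funPTI (h k) (measurable_set1 r)).
rewrite HA//; under [in RHS]eq_integral do rewrite EFinM.
rewrite [in RHS]ge0_integralZl_EFin//; last first.
  exact: (measurable_EFinP _ _).2 (mI r).
rewrite muleCA; congr (_ * (_ * _)).
have mXB : measurable (X @^-1` B) by exact: measurable_funPTI.
by have := integral_indic P measurableT mXB; rewrite setIT => <-.
Qed.

End Independence.

Section ProductRule.
Context (R : realType) d (T : measurableType d) (P : probability T R).
Local Open Scope ereal_scope.

(** Independence is the case where all factors are indicators.  The factors are
    then replaced by general functions one coordinate at a time, the product of
    the others being the weight [H] of [integral_indic_to_fun]. *)
Lemma indep_integral_prod (n : nat) (xi : 'I_n -> {RV P >-> R})
    (g : 'I_n -> R -> R) :
  independent_RVs xi ->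
  (forall i, measurable_fun [set: R] (g i)) -> (forall i r, (0 <= g i r)%R) ->
  (forall i, \int[P]_w (g i (xi i w))%:E < +oo) ->
  \int[P]_w (\prod_(i < n) g i (xi i w))%R%:E =
  \prod_(i < n) \int[P]_w (g i (xi i w))%:E.
Proof.
move=> indep.
(* The coordinates outside of [s] still carry an indicator. *)
suff ind (s : seq 'I_n) : forall g : 'I_n -> R -> R,
    (forall i, i \notin s ->
       exists2 A : set R, measurable A & g i = \1_A) ->
    (forall i, measurable_fun [set: R] (g i)) ->
    (forall i r, (0 <= g i r)%R) ->
    (forall i, \int[P]_w (g i (xi i w))%:E < +oo) ->
    \int[P]_w (\prod_(i < n) g i (xi i w))%R%:E =
    \prod_(i < n) \int[P]_w (g i (xi i w))%:E.
  move=> mg g0 gfin; apply: (ind (index_enum _)) => // i.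
  by rewrite mem_index_enum.
elim: s => [|j s IH] {}g gs mg g0 gfin.
  have /choice[A HA] : forall i, exists A : set R, measurable A /\ g i = \1_A.
    by move=> i; have [//|A mA ->] := gs i; exists A.
  have mA i : measurable (A i) := (HA i).1.
  have intI (B : set T) : measurable B -> \int[P]_w (\1_B w)%:E = P B.
    by move=> mB; rewrite integral_indic// setIT.
  transitivity (P (\bigcap_(i in [set: 'I_n]) (xi i @^-1` A i))).
    rewrite -intI; last first.
      apply: fin_bigcap_measurable; first exact: finite_finset.
      by move=> i _; exact: measurable_funPTI.
    apply: eq_integral => w _; congr EFin; rewrite [RHS]indicE.
    under eq_bigr do rewrite (HA _).2 indicE.
    have [wA|/negP wA] := boolP (w \in _).
      rewrite big1// => i _; rewrite mem_set//.
      by move: wA; rewrite inE; apply.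
    have [i wi] : exists i, ~ A i (xi i w).
      by apply/existsNP => allA; apply: wA; rewrite inE => i _; exact: allA.
    by rewrite (bigD1 i)//= memNset// mul0r.
  rewrite indep//; apply: eq_bigr => i _; rewrite (HA i).2 -intI//.
  exact: measurable_funPTI.
pose upd (h : R -> R) i := if i == j then h else g i.
have updj h : upd h j = h by rewrite /upd eqxx.
have updN h i : i != j -> upd h i = g i by rewrite /upd => /negPf ->.
pose H w := (\prod_(i < n | i != j) g i (xi i w))%R.
pose c := (\prod_(i < n | i != j) fine (\int[P]_w (g i (xi i w))%:E))%R.
have int0 i : 0 <= \int[P]_w (g i (xi i w))%:E.
  by apply: integral_ge0 => w _; rewrite lee_fin.
have cE : \prod_(i < n | i != j) \int[P]_w (g i (xi i w))%:E = c%:E.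
  by rewrite -prodEFin; apply: eq_bigr => i _; rewrite fineK// ge0_fin_numE.
rewrite (bigD1 j)//= cE muleC -(integral_indic_to_fun (H := H))//.
- by apply: eq_integral => w _; rewrite (bigD1 j)//= mulrC.
- rewrite /H; under eq_fun do rewrite big_mkcond/=.
  apply: measurable_prod => i _ /=; case: (i != j) => //.
  exact: measurableT_comp.
- by move=> w; apply: prodr_ge0 => i _.
- by apply: prodr_ge0 => i _; exact: fine_ge0.
- move=> A mA; have mXA : measurable (xi j @^-1` A) by exact: measurable_funPTI.
  have intA : \int[P]_w (\1_A (xi j w))%:E = P (xi j @^-1` A).
    by have := integral_indic P measurableT mXA; rewrite setIT => <-.
  have := IH (upd \1_A); rewrite (bigD1 j)//= updj intA.
  rewrite (eq_bigr (fun i => \int[P]_w (g i (xi i w))%:E)); last first.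
    by move=> i ij; rewrite updN.
  rewrite cE muleC => <-.
  + apply: eq_integral => w _; rewrite (bigD1 j)//= updj mulrC; congr EFin.
    by congr (_ * _)%R; apply: eq_bigr => i ij; rewrite updN.
  + move=> i iNs; have [->|ij] := eqVneq i j; first by exists A; rewrite ?updj.
    by rewrite updN//; apply: gs; rewrite inE negb_or ij.
  + by move=> i; rewrite /upd; case: ifP.
  + by move=> i r; rewrite /upd; case: ifP.
  + move=> i; have [->|ij] := eqVneq i j; last by rewrite updN.
    by rewrite updj intA (le_lt_trans (probability_le1 P mXA))// ltry.
Qed.

(** The moment generating function of an independent vector is the product of
    those of its coordinates. *)
Lemma indep_sub_gaussian (n : nat) (xi : 'I_n -> {RV P >-> R}) (v : R) :
  independent_RVs xi -> (forall i, sub_gaussian (fun _ : 'I_1 => xi i) v) ->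
  sub_gaussian xi v.
Proof.
move=> indep subG t; pose g i r := expR (t i * r).
have g_le i : \int[P]_w (g i (xi i w))%:E <= (expR (v * t i ^+ 2 / 2))%:E.
  have := subG i (fun=> t i); rewrite unlock big_ord1.
  by under eq_integral do rewrite big_ord1.
have gfin i : \int[P]_w (g i (xi i w))%:E < +oo.
  by apply: (le_lt_trans (g_le i)); exact: ltry.
have g0 i r : (0 <= g i r)%R by exact: expR_ge0.
have mg i : measurable_fun [set: R] (g i).
  by apply: measurableT_comp => //; exact: measurable_funM.
rewrite unlock; under eq_integral do rewrite expR_sum.
rewrite (indep_integral_prod indep mg g0 gfin).
have int0 i : 0 <= \int[P]_w (g i (xi i w))%:E.
  by apply: integral_ge0 => w _; rewrite lee_fin.
have fin i : \int[P]_w (g i (xi i w))%:E \is a fin_num by rewrite ge0_fin_numE.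
under eq_bigr do rewrite -(fineK (fin _)).
rewrite prodEFin lee_fin mulr_sumr mulr_suml expR_sum.
apply: ler_prod => i _; rewrite fine_ge0//= -lee_fin fineK//.
Qed.

(** A decreasing sequence in [S] tends to its infimum, and the corresponding
    events decrease to the event of the infimum: continuity from above. *)
Lemma prob_le_inf (g : T -> R) (S : set (\bar R)) (p : \bar R) :
  measurable_fun [set: T] g -> S !=set0 ->
  (forall s, S s -> p <= P [set w | (g w)%:E <= s]) ->
  p <= P [set w | (g w)%:E <= ereal_inf S].
Proof.
move=> mg /set0P S0 Sp; have [u Su u_inf] := ereal_inf_seq S0.
have mle s : measurable [set w | (g w)%:E <= s].
  rewrite -[X in measurable X]setTI; apply: emeasurable_fun_le => //.
  exact/measurable_EFinP.
(* The running minimum stays in [S] and makes the events monotone. *)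
pose v := fix v k := if k is k'.+1 then mine (v k') (u k) else u 0%N.
have Sv k : S (v k) by elim: k => //= k IH; rewrite minElt; case: ifP.
have v_le k : v k <= u k by case: k => //= k; rewrite ge_min lexx orbT.
pose F k := [set w | (g w)%:E <= v k].
have Fdec : nonincreasing_seq F.
  apply/nonincreasing_seqP => k; apply/subsetPset => w /=.
  by rewrite /F/= le_min => /andP[].
have mF k : measurable (F k) by exact: mle.
have mcap : measurable (\bigcap_k F k) by exact: bigcap_measurable.
have cvF := nonincreasing_cvg_mu (mu := P) _ mF mcap Fdec.
apply: (@le_trans _ _ (P (\bigcap_k F k))).
  have /cvF cvP : P (F 0%N) < +oo.
    by rewrite (le_lt_trans (probability_le1 P (mF _)))// ltry.
  rewrite -(cvg_lim _ cvP)//; apply: lime_ge.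
    by apply/cvg_ex; eexists; exact: cvP.
  by apply: nearW => k /=; exact: Sp.
apply: le_measure; rewrite ?inE// => w Fw /=.
rewrite -(cvg_lim _ u_inf)//; apply: lime_ge.
  by apply/cvg_ex; eexists; exact: u_inf.
by apply: nearW => k; exact: le_trans (Fw k I) (v_le k).
Qed.

(** Markov's inequality at the level [1 / del], for the complementary event. *)
Lemma markov_complement (U : T -> R) (del : R) :
  measurable_fun [set: T] U -> (forall w, 0 <= U w)%R -> (0 < del)%R ->
  \int[P]_w (U w)%:E <= 1 ->
  (1 - del)%:E <= P [set w | (del * U w <= 1)%R].
Proof.
move=> mU U0 del0 EU; set A := [set w | _].
have mdU : measurable_fun [set: T] (fun w => del * U w)%R.
  exact: measurable_funM.
have mA : measurable A.
  rewrite /A -[X in measurable X]setTI.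
  exact: measurable_fun_le.
have mAC := measurableC mA.
rewrite -[A]setCK probability_setC// EFinB; apply: leeB => //.
rewrite -[X in P X]setIT -(integral_indic P measurableT mAC).
apply: (@le_trans _ _ (\int[P]_w (del%:E * (U w)%:E))); last first.
  rewrite ge0_integralZl_EFin//; last 3 first.
    - by move=> w _; rewrite lee_fin.
    - exact/measurable_EFinP.
    - exact: ltW.
  by rewrite -[leRHS]mule1; apply: lee_wpmul2l => //; rewrite lee_fin ltW.
apply: ge0_le_integral => //.
- by apply/measurable_EFinP; exact: measurable_indic.
- exact/measurable_EFinP.
- move=> w _; rewrite -EFinM lee_fin indicE.
  have [|_] := boolP (w \in _); last by rewrite mulr_ge0// ltW.
  by rewrite inE /A/= => /negP; rewrite -ltNge => /ltW.
Qed.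

(** The bound [a + c * U w] has no definite sign; adding [|a|] brings both sides
    into the calculus of integrals of nonnegative functions. *)
Lemma integral_le_affine (g U : T -> R) (a c : R) :
  measurable_fun [set: T] g -> (forall w, 0 <= g w)%R ->
  measurable_fun [set: T] U -> (forall w, 0 <= U w)%R ->
  (0 <= c)%R -> \int[P]_w (U w)%:E <= 1 ->
  (forall w, g w <= a + c * U w)%R ->
  \int[P]_w (g w)%:E <= (a + c)%:E.
Proof.
move=> mg g0 mU U0 c0 EU gle; set k := `|a|%R.
have k0 : (0 <= k)%R by exact: normr_ge0.
have ak0 : (0 <= a + k)%R by rewrite -lerBlDl sub0r /k -normrN ler_norm.
have intk (b : R) : \int[P]_w b%:E = b%:E.
  by have := expectation_cst P b; rewrite unlock.
have : \int[P]_w ((g w)%:E + k%:E) <= \int[P]_w ((a + k)%:E + c%:E * (U w)%:E).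
  apply: ge0_le_integral => //.
  - by move=> w _; rewrite lee_fin addr_ge0.
  - by apply/measurable_EFinP; exact: measurable_funD.
  - apply/measurable_EFinP; apply: measurable_funD => //.
    exact: measurable_funM.
  - by move=> w _; rewrite lee_fin addrAC lerD2r.
rewrite !ge0_integralD//; first last.
  all: try by [apply/measurable_EFinP; exact: measurable_funM
    | exact/measurable_EFinP | move=> w _; rewrite lee_fin ?mulr_ge0].
rewrite !intk ge0_integralZl_EFin//; first last.
  all: try by [exact/measurable_EFinP | move=> w _; rewrite lee_fin].
move=> le_gk; rewrite -(leeD2rE _ _ (_ : k%:E \is a fin_num))//.
apply: (le_trans le_gk); rewrite -[leRHS]EFinD addrAC [in leRHS]EFinD.
apply: leeD2l.
by rewrite -[leRHS]mule1; apply: lee_wpmul2l.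
Qed.

End ProductRule.

(** * The exponential moment and the theorem *)

Section ExponentialMoment.
Context (R : realType) d (T : measurableType d) (P : probability T R).
Context (X : Type) (n M : nat) (x : 'I_n -> X) (f : 'I_M -> X -> R).
Context (xi : 'I_n -> {RV P >-> R}).

Lemma measurable_exp_moment pi (beta m : R) lam :
  measurable_fun [set: T]
    (fun w => exp_moment x f pi beta m lam (fun i => xi i w)).
Proof.
apply: measurable_sum => j; apply: measurable_funM => //.
apply: measurableT_comp => //; apply: measurable_funB => //.
apply: measurable_funM => //; apply: measurable_sum => i.
exact: measurable_funM.
Qed.

Lemma exp_moment_ge0 pi (beta m : R) lam z : simplex R M pi ->
  0 <= exp_moment x f pi beta m lam z.
Proof.
by move=> [p0 _]; apply: sumr_ge0 => j _; rewrite mulr_ge0// expR_ge0.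
Qed.

(** Each summand is a moment generating function of the noise, at the argument
    (2/beta) (f_j - f_lam): the sub-Gaussian bound contributes
    2 v / beta^2 |f_j - f_lam|^2 to the exponent, and the condition
    2 v <= beta m says that the compensating term is at least that large. *)
Lemma integral_exp_moment_le1 pi (v beta m : R) lam :
  sub_gaussian xi v -> simplex R M pi -> 0 < beta -> 2 * v <= beta * m ->
  (\int[P]_w (exp_moment x f pi beta m lam (fun i => xi i w))%:E <= 1)%E.
Proof.
move=> subG [p0 p1] b0 vm.
pose D j := \sum_(i < n) (f j (x i) - mixture f lam (x i)) ^+ 2.
pose t j i := 2 / beta * (f j (x i) - mixture f lam (x i)).
pose G j w := expR (\sum_(i < n) t j i * xi i w).
have mG j : measurable_fun [set: T] (G j).
  apply: measurableT_comp => //; apply: measurable_sum => i.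
  exact: measurable_funM.
have UE w : exp_moment x f pi beta m lam (fun i => xi i w) =
    \sum_(j < M) pi j * expR (- (m / beta * D j)) * G j w.
  apply: eq_bigr => j _; rewrite expRD mulrA mulrAC -/(D j); congr (_ * expR _).
  by rewrite mulr_sumr; apply: eq_bigr => i _; rewrite /t; ring.
under eq_integral do rewrite UE -sumEFin.
have k0 j : 0 <= pi j * expR (- (m / beta * D j)).
  by rewrite mulr_ge0// expR_ge0.
rewrite ge0_integral_sum//; last 2 first.
  - by move=> j; apply/measurable_EFinP; exact: measurable_funM.
  - by move=> j w _; rewrite lee_fin mulr_ge0// expR_ge0.
rewrite -[leRHS]/(1%:E) -p1 -sumEFin; apply: lee_sum => j _.
under eq_integral do rewrite EFinM.
rewrite ge0_integralZl_EFin//; last 2 first.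
  - by move=> w _; rewrite lee_fin expR_ge0.
  - exact/measurable_EFinP.
have := subG (t j); rewrite unlock -/(G j _) => EG.
apply: (le_trans (lee_wpmul2l _ EG)); first by rewrite lee_fin.
rewrite -EFinM lee_fin -(mulrA (pi j)) -expRD -[leRHS]mulr1 ler_wpM2l//.
rewrite -[leRHS]expR0 ler_expR.
have -> : \sum_(i < n) t j i ^+ 2 = 4 / beta ^+ 2 * D j.
  rewrite mulr_sumr; apply: eq_bigr => i _; rewrite /t; field.
  by rewrite gt_eqF.
have D0 : 0 <= D j by apply: sumr_ge0 => i _; exact: sqr_ge0.
rewrite (_ : _ + _ = - ((beta * m - 2 * v) * (D j / beta ^+ 2))); last first.
  have bn0 : beta != 0 by rewrite gt_eqF.
  by rewrite /=; field.
by rewrite oppr_le0 mulr_ge0 ?subr_ge0// divr_ge0// exprn_ge0// ltW.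
Qed.
End ExponentialMoment.

Theorem theorem3p1 (R : realType) (d : measure_display) (T : measurableType d)
    (P : probability T R) (X : Type) (n M : nat)
    (x : 'I_n -> X) (f : 'I_M -> X -> R) (eta : X -> R)
    (xi : 'I_n -> {RV P >-> R}) (rho : R -> R) (sigma nu beta : R)
    (pi : 'I_M -> R) (lamt : n.-tuple R -> 'I_M -> R)
    (n_gt0 : (0 < n)%N)
    (rho_ge : forall t : R, 0 <= t <= 1 -> t <= rho t)
    (rho_convex :
       convex_function (`[0, 1]%classic : set R) (fun t => t * ln (rho t)))
    (nu01 : 0 < nu < 1)
    (pi_simplex : simplex R M pi)
    (sigma2_gt0 : 0 < sigma ^+ 2)
    (xi_indep : independent_RVs xi)
    (xi_subG : forall i, sub_gaussian (fun _ : 'I_1 => xi i) (sigma ^+ 2))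
    (beta_ge : 2 * sigma ^+ 2 / Num.min nu (1 - nu) <= beta)
    (lamt_measurable : forall j, measurable_fun [set: n.-tuple R]
       (fun y => lamt y j))
    (lamt_argmin : forall w : T, let y := obs x eta xi w in
       is_argmin (simplex R M) (Qcrit x f rho pi nu beta (tnth y)) (lamt y)) :
  (forall delta : R, 0 < delta < 1 ->
     ((1 - delta)%:E <=
       P [set w | (MSE x eta (mixture f (lamt (obs x eta xi w))))%:E <=
            ereal_inf [set (Pcrit x f eta nu lam)%:E
                             + (beta / n%:R)%:E * Krho rho lam pi
                             + (beta / n%:R * ln (1 / delta))%:E
                      | lam in simplex R M]])%E) /\
  ('E_P[fun w => MSE x eta (mixture f (lamt (obs x eta xi w)))] <=
     ereal_inf [set (Pcrit x f eta nu lam)%:E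
                      + (beta / n%:R)%:E * Krho rho lam pi
               | lam in simplex R M])%E.
Proof.
pose m := Num.min nu (1 - nu); pose c := beta / n%:R.
have [nu0 nu1] := andP nu01.
have m0 : 0 < m by rewrite lt_min nu0 subr_gt0.
have vm : 2 * sigma ^+ 2 <= beta * m by rewrite -ler_pdivrMr.
have beta0 : 0 < beta.
  by apply: lt_le_trans beta_ge; rewrite divr_gt0// mulr_gt0.
have c0 : 0 < c by rewrite divr_gt0// ltr0n.
pose U lam w := exp_moment x f pi beta m lam (fun i => xi i w).
have U0 lam w : 0 <= U lam w by exact: exp_moment_ge0.
have mU lam : measurable_fun [set: T] (U lam) by exact: measurable_exp_moment.
have EU lam : (\int[P]_w (U lam w)%:E <= 1)%E.
  exact: integral_exp_moment_le1 (indep_sub_gaussian xi_indep xi_subG) _ _ _.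
pose risk w := MSE x eta (mixture f (lamt (obs x eta xi w))).
have risk0 w : 0 <= risk w.
  by rewrite /risk/MSE mulr_ge0 ?invr_ge0// sumr_ge0// => i _; exact: sqr_ge0.
have mrisk : measurable_fun [set: T] risk.
  have mobs : measurable_fun [set: T] (obs x eta xi).
    apply/measurable_fun_tnthP => i.
    rewrite (_ : _ \o _ = fun w => eta (x i) + xi i w).
      exact: measurable_funD.
    by apply/funext => w /=; rewrite tnth_mktuple.
  apply: measurable_funM => //; apply: measurable_sum => i.
  apply: measurable_funX; apply: measurable_funB => //.
  apply: measurable_sum => j; apply: measurable_funM => //.
  exact: measurableT_comp (lamt_measurable j) mobs.
pose F lam := Pcrit x f eta nu lam + c * Krho_real rho lam pi.
have oracle lam s w : simplex R M lam -> dominated lam pi ->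
    risk w <= F lam + c * (s + expR (- s) * U lam w - 1).
  move=> sl dl; apply: oracle_inequality => //.
  have := lamt_argmin w; congr (is_argmin _ (Qcrit _ _ _ _ _ _ _)).
  by apply/funext => i; rewrite tnth_mktuple.
have FE lam : simplex R M lam -> dominated lam pi ->
    ((Pcrit x f eta nu lam)%:E + c%:E * Krho rho lam pi)%E = (F lam)%:E.
  by move=> sl dl; rewrite Krho_dominated.
have Fy lam : ~ dominated lam pi ->
    ((Pcrit x f eta nu lam)%:E + c%:E * Krho rho lam pi)%E = +oo%E.
  by move=> nd; rewrite Krho_not_dominated// gt0_muley ?lte_fin.
split=> [delta /andP[delta0 delta1]|].
  apply: (prob_le_inf mrisk); first by eexists; exists pi.
  move=> _ [lam sl <-]; have [dl|nd] := pselect (dominated lam pi); last first.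
    rewrite Fy//= addye// [X in P X](_ : _ = setT); last first.
      by apply/seteqP; split=> // w _ /=; rewrite leey.
    by rewrite probability_setT lee_fin gerBl ltW.
  rewrite FE// -EFinD.
  have := markov_complement (mU lam) (U0 lam) delta0 (EU lam).
  move=> /le_trans; apply; apply: le_measure; rewrite ?inE.
  - rewrite -[X in measurable X]setTI; apply: measurable_fun_le => //.
    exact: measurable_funM.
  - rewrite -[X in measurable X]setTI; apply: emeasurable_fun_le => //.
    exact/measurable_EFinP.
  (* With s = log(1/delta) the correction is s + delta U - 1. *)
  move=> w /= dU; rewrite lee_fin.
  apply: (le_trans (oracle lam (ln (1 / delta)) w sl dl)).
  rewrite lerD2l// ler_pM2l// -lnV ?posrE ?divr_gt0// div1r invrK lnK ?posrE//.
  lra.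
apply: le_ereal_inf_tmp => _ [lam sl <-].
have [dl|nd] := pselect (dominated lam pi); last by rewrite Fy ?leey.
rewrite FE// unlock.
have bound w : risk w <= F lam - c + c * U lam w.
  by have := oracle lam 0 w sl dl; rewrite oppr0 expR0; lra.
rewrite -[F lam](subrK c).
exact: integral_le_affine mrisk risk0 (mU lam) (U0 lam) (ltW c0) (EU lam) bound.
Qed.
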